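(* Let $U_8^{22}=\{L(C)\in TLeib_8 : c_{3,4}=0,\ c_{2,3}=0,\ c_{2,4}\neq 0,\ c_{1,2}=c_{1,1}=c_{0,1}=0,\ c_{1,4}\neq 0\}$. 1. Two algebras $L(C)$ and $L(C')$ from $U_8^{22}$ are isomorphic if and only if $$\frac{{c'}_{2,4}^{8}c'_{0,0}}{{c'}_{1,4}^{7}}=\frac{c_{2,4}^8c_{0,0}}{c_{1,4}^7}\quad\text{and}\quad\frac{c'_{1,3}}{c'_{2,4}}=\frac{c_{1,3}}{c_{2,4}}.$$ 2. For any $\lambda_1,\lambda_2\in\mathbb{C}$ there exists $L(C)\in U_8^{22}$ with $\frac{c_{2,4}^8c_{0,0}}{c_{1,4}^7}=\lambda_1$ and $\frac{c_{1,3}}{c_{2,4}}=\lambda_2$. Moreover, the orbits (isomorphism classes) in $U_8^{22}$ are parameterized by the algebras $L(\lambda_1,0,0,0,\lambda_2,1,0,0,1,0)$, $\lambda_1,\lambda_2\in\mathbb{C}$: these algebras lie in $U_8^{22}$ and every algebra in $U_8^{22}$ is isomorphic to one of them.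
   Context: All algebras are over $\mathbb{C}$. For $C=(c_{0,0},c_{0,1},c_{1,1},c_{1,2},c_{1,3},c_{1,4},c_{1,5},c_{2,3},c_{2,4},c_{3,4})\in\mathbb{C}^{10}$, $L(C)$ denotes the $8$-dimensional complex algebra with basis $e_0,\dots,e_7$ and products (products of basis vectors not listed are zero): $[e_i,e_0]=e_{i+1}$ for $1\le i\le 6$; $[e_0,e_i]=-e_{i+1}$ for $2\le i\le 6$; $[e_0,e_0]=c_{0,0}e_7$; $[e_0,e_1]=-e_2+c_{0,1}e_7$; $[e_1,e_1]=c_{1,1}e_7$; $[e_1,e_2]=-[e_2,e_1]=c_{1,2}e_4+c_{1,3}e_5+c_{1,4}e_6+c_{1,5}e_7$; $[e_1,e_3]=-[e_3,e_1]=c_{1,2}e_5+c_{1,3}e_6+c_{1,4}e_7$; $[e_1,e_4]=-[e_4,e_1]=(c_{1,2}-c_{2,3})e_6+(c_{1,3}-c_{2,4})e_7$; $[e_1,e_5]=-[e_5,e_1]=(c_{1,2}-2c_{2,3})e_7$; $[e_2,e_3]=-[e_3,e_2]=c_{2,3}e_6+c_{2,4}e_7$; $[e_2,e_4]=-[e_4,e_2]=c_{2,3}e_7$; $[e_i,e_{7-i}]=-[e_{7-i},e_i]=(-1)^ic_{3,4}e_7$ for $1\le i\le 6$. $TLeib_8$ is the set of all $L(C)$ with $c_{3,4}(c_{2,3}+2c_{1,2})=0$ (the condition for $L(C)$ to be a Leibniz algebra, i.e. to satisfy $[x,[y,z]]=[[x,y],z]-[[x,z],y]$). The entries of $C'$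 are denoted $c'_{i,j}$, in the same order. ''Isomorphic'' means isomorphic as algebras over $\mathbb{C}$; an orbit is an isomorphism class. *)

(* Defs.v *)
From HB Require Import structures.
From mathcomp Require Import all_boot all_order all_algebra.
From mathcomp Require Import complex.
From mathcomp Require Import reals.

Set Implicit Arguments.
Unset Strict Implicit.
Unset Printing Implicit Defensive.

Import GRing.Theory.
Local Open Scope ring_scope.

(* A (not necessarily associative) algebra is a vector space together with its
   product, passed as a two-argument function. *)
Definition isomorphic (K : fieldType) (V W : lmodType K)
    (mulV : V -> V -> V) (mulW : W -> W -> W) : Prop :=
  exists f : {linear V -> W},
    bijective f /\ forall x y : V, f (mulV x y) = mulW (f x) (f y).

Record params (K : Type) : Type := Params {
  c00 : K; c01 : K; c11 : K; c12 : K; c13 : K;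
  c14 : K; c15 : K; c23 : K; c24 : K; c34 : K }.

Definition e (K : fieldType) (k : nat) : 'rV[K]_8 := delta_mx 0 (inord k).
Arguments e {K} k.

Definition basis_prod (K : fieldType) (c : params K) (i j : nat) : 'rV[K]_8 :=
  let p12 := c12 c *: e 4 + c13 c *: e 5 + c14 c *: e 6 + c15 c *: e 7 in
  let p13 := c12 c *: e 5 + c13 c *: e 6 + c14 c *: e 7 in
  let p14 := (c12 c - c23 c) *: e 6 + (c13 c - c24 c) *: e 7 in
  let p15 := (c12 c - 2 * c23 c) *: e 7 in
  let p23 := c23 c *: e 6 + c24 c *: e 7 in
  let p24 := c23 c *: e 7 in
  match i, j with
  | 0, 0 => c00 c *: e 7
  | 0, 1 => - e 2 + c01 c *: e 7
  | 0, (2 | 3 | 4 | 5 | 6) => - e j.+1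
  | (1 | 2 | 3 | 4 | 5 | 6), 0 => e i.+1
  | 1, 1 => c11 c *: e 7
  | 1, 2 => p12 | 2, 1 => - p12
  | 1, 3 => p13 | 3, 1 => - p13
  | 1, 4 => p14 | 4, 1 => - p14
  | 1, 5 => p15 | 5, 1 => - p15
  | 2, 3 => p23 | 3, 2 => - p23
  | 2, 4 => p24 | 4, 2 => - p24
  (* For 1 <= i <= 6, (-1) ^ i and (-1) ^ (7 - i) are opposite, so this single
     clause covers both [e_i, e_(7-i)] and [e_(7-i), e_i]. *)
  | _, _ => if [&& 1 <= i, i <= 6 & i + j == 7]%N
            then ((-1) ^+ i * c34 c) *: e 7 else 0
  end.

Definition L (K : fieldType) (c : params K) (x y : 'rV[K]_8) : 'rV[K]_8 :=
  \sum_(i < 8) \sum_(j < 8) (x 0 i * y 0 j) *: basis_prod c i j.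

(* Families of algebras L c are given as predicates on c; this loses nothing,
   since c can be read off from the products of basis vectors in L c. *)
Definition TLeib8 (K : fieldType) (c : params K) : Prop :=
  c34 c * (c23 c + 2 * c12 c) = 0.

Definition U8_22 (K : fieldType) (c : params K) : Prop :=
  TLeib8 c /\
  [/\ c34 c = 0, c23 c = 0, c24 c != 0,
      [/\ c12 c = 0, c11 c = 0 & c01 c = 0] & c14 c != 0].

(* Main.v *)
Require Import Defs.
From HB Require Import structures.
From mathcomp Require Import all_boot all_order all_algebra.
From mathcomp Require Import complex.
From mathcomp Require Import reals.
From mathcomp Require Import ring zify.

Set Implicit Arguments.
Unset Strict Implicit.
Unset Printing Implicit Defensive.

Import GRing.Theory.
Local Open Scope ring_scope.

(** Rescaling the adapted basis acts on the parameters of the family.  If the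
    first two basis vectors of [L c'] are replaced by vectors with leading terms
    [A *: e 0] and [D *: e 1], then [e k] is replaced, for [2 <= k], by a vector
    with leading term [(A ^+ k.-1 * D) *: e k], and comparing leading
    coefficients in [[e0, e0]], [[e2, e3]] and [[e1, e2]] gives
      [c00 c' = c00 c * A^4 * D],  [c24 c' * D = c24 c * A^3],
      [c13 c' * D = c13 c * A^3],  [c14 c' * D = c14 c * A^4].
    This relation is [rescaled].  The point is that in the family [U8_22]
    it is exactly isomorphism, with [c15] unconstrained.

    Isomorphic algebras are rescaled ([isomorphic_rescaled]).  For an isomorphism
    [f], the vectors [m k = f (e k)] are obtained from [m 1] by repeated right
    multiplication by [m 0].  Modulo terms lying three places further, right
    multiplication by [y] shifts the coordinates of a vector of the derived
    algebra and multiplies them by the coordinate [y_0] ([L_shift]), so that the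
    first two nonzero coordinates of every [m k] are known ([L_powers]).
    Surjectivity of [f] makes the determinant of the [e 0], [e 1] coordinates of
    [m 0] and [m 1] nonzero; as [[e1, e2]] lies in the span of [e 5], [e 6],
    [e 7], this forces [m 1] to have no component along [e 0].  What remains
    is to read off coordinates.  The coordinate along [e 6] of [[m 1, m 2]] has
    a contribution of the second coefficient of [m 1], and it cancels
    thanks to the equation already found for [c13].

    Conversely ([rescaled_isomorphic]), a diagonal change of basis adjusts all
    parameters but [c15].  Replacing [e 1] by [D *: e 1 + F *: e 3] changes the
    [e 7] coefficient of [[e1, e2]] by a nonzero multiple of [2 * c24 * F], so a suitable
    [F] yields any prescribed [c15].

    Finally, [c24^8 * c00 / c14^7] and [c13 / c24] are unchanged by rescaling, and
    they determine the orbit: [A] must be the quotient of [c14 c' / c14 c] by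
    [c24 c' / c24 c], and then [D] must be [A^3 * c24 c / c24 c'], so that no
    root extraction is needed ([rescaled_invariants]). *)

Local Notation "x @_ k" := (x 0 (inord k : 'I_8)) (at level 3, k at level 2, format "x @_ k").

(** * Coordinates of products *)

Section Coordinates.
Variable K : fieldType.
Implicit Types (x y : 'rV[K]_8) (c : params K).

Lemma e_coord k l : (k < 8)%N -> (l < 8)%N -> (@e K k)@_l = (l == k)%:R.
Proof. by move=> k8 l8; rewrite mxE eqxx -(inj_eq val_inj) /= !inordK. Qed.

Lemma eq_coord x y : (forall k, (k < 8)%N -> x@_k = y@_k) -> x = y.
Proof. by move=> xy; apply/rowP => j; rewrite -[j]inord_val xy. Qed.

Lemma vec_expand x : x = \sum_(0 <= k < 8) x@_k *: e k.
Proof.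
rewrite big_mkord {1}[x]row_sum_delta; apply: eq_bigr => i _.
by rewrite /e inord_val.
Qed.

Lemma L_basis c i j : (i < 8)%N -> (j < 8)%N ->
  L c (e i) (e j) = basis_prod c i j.
Proof.
move=> i8 j8; rewrite /L (bigD1 (Ordinal i8)) //= (bigD1 (Ordinal j8)) //=.
have eE n (n8 : (n < 8)%N) (m : 'I_8) : (@e K n) 0 m = (m == Ordinal n8)%:R.
  by rewrite mxE eqxx -(inj_eq val_inj) /= inordK.
rewrite !big1 ?addr0 => [|k ki|k kj].
- by rewrite !eE !eqxx mulr1 scale1r.
- by rewrite big1 // => l _; rewrite (eE i) (negPf ki) mul0r scale0r.
by rewrite (eE j) (negPf kj) mulr0 scale0r.
Qed.

Definition prod_coord c x y k : K :=
  let b i j := x@_i * y@_j - x@_j * y@_i in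
  match k with
  | 2 => b 1 0
  | 3 => b 2 0
  | 4 => b 3 0
  | 5 => b 4 0 + c13 c * b 1 2
  | 6 => b 5 0 + c14 c * b 1 2 + c13 c * b 1 3
  | 7 => b 6 0 + c00 c * (x@_0 * y@_0) + c15 c * b 1 2 + c14 c * b 1 3
         + (c13 c - c24 c) * b 1 4 + c24 c * b 2 3
  | _ => 0
  end.

(** On [U8_22] the product is skew-symmetric up to the term in [c00]; the
    2 x 2 minors of [x] and [y] make this visible. *)
Lemma L_coord c x y k : U8_22 c -> (k < 8)%N ->
  (L c x y)@_k = prod_coord c x y k.
Proof.
case: c => a ? ? ? p q r ? s ?.
case=> _ [/= -> -> _ [-> -> ->] _] k8.
have -> : forall c, L c x y =
   \sum_(0 <= i < 8) \sum_(0 <= j < 8) (x@_i * y@_j) *: basis_prod c i j.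
  move=> c; rewrite big_mkord; apply: eq_bigr => i _.
  by rewrite big_mkord; apply: eq_bigr => j _; rewrite !inord_val.
rewrite /index_iota /= !big_cons !big_nil /= !addr0.
rewrite !mulr0 !scale0r !subr0 !add0r !addr0.
have E l : (l < 8)%N -> (@e K l)@_k = (k == l)%:R by move=> l8; apply: e_coord.
move: (E 2%N isT) (E 3%N isT) (E 4%N isT) (E 5%N isT) (E 6%N isT) (E 7%N isT).
rewrite /basis_prod /= ?(mulr0, scale0r, subr0, add0r, addr0, scaler0, oppr0).
(* The basis vectors are abstracted: once the 64 products are expanded, only
   their k-th coordinates matter. *)
move: (e 2) (e 3) (e 4) (e 5) (e 6) (e 7) => v2 v3 v4 v5 v6 v7.
move=> {E} E2 E3 E4 E5 E6 E7.
rewrite !linearD /= !mxE E2 E3 E4 E5 E6 E7.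
move: k k8 {E2 E3 E4 E5 E6 E7} => [|[|[|[|[|[|[|[|//]]]]]]]] _ /=; ring.
Qed.

(** Right multiplication by [e 0] shifts the basis, and right multiplication by
    [e i] with [1 <= i] sends [e k], for [2 <= k], to the span of the [e j]
    with [k + 3 <= j]. *)
Lemma L_shift c x y k j : U8_22 c -> (2 <= k)%N ->
    (forall i, (i < k)%N -> x@_i = 0) -> (j < 7)%N -> (j < k.+2)%N ->
  (L c x y)@_j.+1 = x@_j * y@_0.
Proof.
move=> Uc k2 x0 j7 jk; rewrite L_coord // /prod_coord.
rewrite (x0 0%N (ltnW k2)) (x0 1%N k2).
have x0_lt i : (i.+1 < j)%N -> x@_i = 0 by move=> ij; apply: x0; lia.
case: j j7 jk x0_lt => [|[|[|[|[|[|[|//]]]]]]] _ _ x0_lt.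
- by rewrite (x0 0%N (ltnW k2)) mul0r.
- by rewrite (x0 1%N k2); ring.
- by ring.
- by ring.
- by rewrite (x0_lt 2%N) //; ring.
- by rewrite (x0_lt 2%N) ?(x0_lt 3%N) //; ring.
- by rewrite (x0_lt 2%N) ?(x0_lt 3%N) ?(x0_lt 4%N) //; ring.
Qed.

(** Only two coordinates of the iterated right products are tracked: the leading
    one gives the diagonal part of an isomorphism, the next one is needed for the
    [e 6] coordinate of [[e1, e2]], which involves both [e 5] and [e 6]. *)
Lemma L_powers c y (m : nat -> 'rV[K]_8) : U8_22 c ->
    (m 2%N)@_0 = 0 -> (m 2%N)@_1 = 0 ->
    (forall k, (2 <= k < 7)%N -> m k.+1 = L c (m k) y) ->
  forall k, (2 <= k <= 7)%N ->
  [/\ forall i, (i < k)%N -> (m k)@_i = 0,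
      (m k)@_k = (m 2%N)@_2 * y@_0 ^+ (k - 2)
    & (k < 7)%N -> (m k)@_k.+1 = (m 2%N)@_3 * y@_0 ^+ (k - 2)].
Proof.
move=> Uc m20 m21 mS; elim=> [//|k IH]; rewrite ltnS => /andP[].
rewrite leq_eqVlt => /predU1P[<- _|k2 k7].
  by split=> [[|[|]]| |] //; rewrite ?expr0 mulr1.
have {IH} [m0 mk mk1] := IH (introT andP (conj k2 (ltnW k7))).
rewrite mS ?k2 // subSn // exprSr !mulrA.
have shift j := @L_shift c _ y k j Uc k2 m0.
split=> [[|i] ik||k6].
- by rewrite L_coord.
- by rewrite shift ?m0 ?mul0r //; lia.
- by rewrite shift ?mk.
- by rewrite shift ?mk1.
Qed.

End Coordinates.

(** * Rescaled algebras are isomorphic *)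

(** The effect on the parameters of a change of basis with diagonal coefficients
    [A] at [e 0] and [D] at [e 1]. *)
Definition rescaled (K : fieldType) (c c' : params K) : Prop :=
  exists A D : K, [/\ A != 0 /\ D != 0, c00 c' = c00 c * A ^+ 4 * D,
    c24 c' * D = c24 c * A ^+ 3, c13 c' * D = c13 c * A ^+ 3
    & c14 c' * D = c14 c * A ^+ 4].

Section ScalingMap.
Variables (K : fieldType) (A D F : K).

(** Coordinates of the linear map sending [e 0] to [A *: e 0], [e 1] to
    [D *: e 1 + F *: e 3] and [e k], for [2 <= k], to
    [A ^+ k.-1 *: (D *: e k + F *: e k.+2)] (with [e k.+2 = 0] past [e 7]), which
    is forced by multiplicativity from the images of [e 0] and [e 1]. *)
Definition scaling_coord (x : 'rV[K]_8) (k : nat) : K :=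
  match k with
  | 0 => A * x@_0
  | (j.+2 as i).+1 => A ^+ i * D * x@_i.+1 + A ^+ j * F * x@_j.+1
  | i.+1 => A ^+ i * D * x@_i.+1
  end.

Definition scaling_map (x : 'rV[K]_8) : 'rV[K]_8 := \row_k scaling_coord x k.

Lemma scaling_mapE x k : (k < 8)%N -> (scaling_map x)@_k = scaling_coord x k.
Proof. by move=> k8; rewrite mxE inordK. Qed.

Fact scaling_map_is_linear : linear scaling_map.
Proof.
move=> a x y; apply: eq_coord => k k8; rewrite scaling_mapE //.
rewrite [in RHS]mxE [X in _ = X + _]mxE !scaling_mapE // /scaling_coord.
by case: k k8 => [|[|[|k]]] _ /=; rewrite !mxE; ring.
Qed.

HB.instance Definition _ := GRing.isLinear.Build K 'rV[K]_8 'rV[K]_8 *:%R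
  scaling_map scaling_map_is_linear.

End ScalingMap.

Section Classification.
Variable K : fieldType.
Implicit Types (x y : 'rV[K]_8) (c : params K).

Lemma linear_inj_bij n (f : {linear 'rV[K]_n -> 'rV[K]_n}) :
  (forall v, f v = 0 -> v = 0) -> bijective f.
Proof.
move=> f0; have uM : lin1_mx f \in unitmx.
  by rewrite -row_free_unit; apply: inj_row_free => v; rewrite mul_rV_lin1 => /f0.
exists (mulmxr (invmx (lin1_mx f))) => x /=.
  by rewrite -mul_rV_lin1 mulmxK.
by rewrite -mul_rV_lin1 mulmxKV.
Qed.

(** The matrix of the map is triangular with nonzero diagonal. *)
Lemma scaling_map_bij (A D F : K) : A != 0 -> D != 0 -> bijective (scaling_map A D F).
Proof.
move=> A0 D0; apply: linear_inj_bij => x fx0.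
have {fx0} x0 k : (k < 8)%N -> scaling_coord A D F x k = 0.
  by move=> k8; rewrite -scaling_mapE // fx0 mxE.
have AD0 i : A ^+ i * D != 0 by rewrite mulf_neq0 ?expf_neq0.
apply: eq_coord; elim/ltn_ind => k IH k8; move: (x0 k k8).
case: k IH k8 => [|[|[|k]]] IH k8 /=; rewrite mxE;
  rewrite ?(IH k.+1) ?(ltn_trans _ k8) // ?mxE ?mulr0 ?addr0 => /eqP;
  rewrite mulf_eq0 ?(negPf (AD0 _)) ?(negPf A0) /= => /eqP.
all: exact.
Qed.

(** The free coefficient [F] is spent on matching [c15]; this divides by
    [2 * c24 c']. *)
Lemma rescaled_isomorphic c c' : (2 : K) != 0 -> U8_22 c -> U8_22 c' ->
  rescaled c c' -> isomorphic (L c) (L c').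
Proof.
move=> n2 Uc Uc' [A [D [[A0 D0] a'E s'E p'E q'E]]].
have s'0 : c24 c' != 0 by case: Uc' => _ [].
(* Solves the e 7 coordinate of the relation for [e1, e2]. *)
pose F := (c15 c' * D - c15 c * A ^+ 5) / (2 * c24 c').
exists (scaling_map A D F); split; first exact: scaling_map_bij.
move=> x y; apply: eq_coord => k k8.
rewrite scaling_mapE // [RHS]L_coord //.
(* Expressing the parameters of c through those of c' leaves only A and D in
   denominators. *)
have aE : c00 c = c00 c' / (A ^+ 4 * D) by rewrite a'E; field; rewrite ?A0 ?D0.
have sE : c24 c = c24 c' * D / A ^+ 3 by rewrite s'E; field.
have pE : c13 c = c13 c' * D / A ^+ 3 by rewrite p'E; field.
have qE : c14 c = c14 c' * D / A ^+ 4 by rewrite q'E; field.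
have rE : c15 c = (c15 c' * D - 2 * c24 c' * F) / A ^+ 5.
  by rewrite /F; field; rewrite ?s'0 ?A0 ?n2.
move: F rE => F rE.
case: k k8 => [|[|[|[|[|[|[|[|//]]]]]]]] _;
  rewrite /scaling_coord /= ?L_coord //= ?scaling_mapE //= /scaling_coord /=
    ?aE ?sE ?pE ?qE ?rE; field; rewrite ?A0 ?D0 //.
Qed.

(** * Isomorphic algebras are rescaled *)

Lemma isomorphic_rescaled c c' : U8_22 c -> U8_22 c' ->
  isomorphic (L c) (L c') -> rescaled c c'.
Proof.
move=> Uc Uc' [f [[g fK gK] fM]].
pose m k : 'rV[K]_8 := f (e k).
have mM i j : (i < 8)%N -> (j < 8)%N -> L c' (m i) (m j) = f (basis_prod c i j).
  by move=> i8 j8; rewrite -fM L_basis.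
have mS k : (0 < k < 7)%N -> m k.+1 = L c' (m k) (m 0%N).
  by case: k => [|[|[|[|[|[|[|//]]]]]]] //= _; rewrite mM.
have c'E x y k := L_coord x y (k := k) Uc'.
have m2E : m 2%N = L c' (m 1%N) (m 0%N) by rewrite mS.
have m20 : (m 2%N)@_0 = 0 by rewrite m2E c'E.
have m21 : (m 2%N)@_1 = 0 by rewrite m2E c'E.
have mS2 k : (2 <= k < 7)%N -> m k.+1 = L c' (m k) (m 0%N).
  by case/andP=> k2 k7; rewrite mS // (ltnW k2).
have mpow := L_powers Uc' m20 m21 mS2.
set A := (m 0%N)@_0; set D := (m 1%N)@_1.
have m22 : (m 2%N)@_2 = D * A - (m 1%N)@_0 * (m 0%N)@_1.
  by rewrite m2E c'E // /prod_coord; ring.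
(* Modulo e 2, ..., e 7 the map is a surjective endomorphism of a plane. *)
have m22_neq0 : (m 2%N)@_2 != 0.
  have fE x j : (j < 2)%N -> (f x)@_j = x@_0 * (m 0%N)@_j + x@_1 * (m 1%N)@_j.
    move=> j2; rewrite {1}(vec_expand x) linear_sum summxE.
    rewrite 2?big_ltn // big_nat_cond big1 ?addr0 => [|k].
      by rewrite !linearZ !mxE.
    rewrite andbT => k28; have [m0 _ _] := mpow k k28.
    by rewrite linearZ mxE [X in _ * X]m0 ?mulr0 //; lia.
  have gE i j : (i < 2)%N -> (j < 2)%N ->
      (i == j)%:R = (g (e i))@_0 * (m 0%N)@_j + (g (e i))@_1 * (m 1%N)@_j.
    by move=> i2 j2; rewrite -fE // gK e_coord ?(eq_sym i) //; lia.
  have := (gE 0%N 0%N isT isT, gE 0%N 1%N isT isT, gE 1%N 0%N isT isT, gE 1%N 1%N isT isT).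
  rewrite /= -/A -/D; set x0 := (g _)@_0; set x1 := (g (e 0))@_1.
  set z0 := (g (e 1))@_0; set z1 := (g (e 1))@_1 => -[[[E00 E01] E10] E11].
  have det1 : (x0 * z1 - x1 * z0) * (m 2%N)@_2 = 1.
    transitivity ((x0 * A + x1 * (m 1%N)@_0) * (z0 * (m 0%N)@_1 + z1 * D)
        - (x0 * (m 0%N)@_1 + x1 * D) * (z0 * A + z1 * (m 1%N)@_0)).
      by rewrite m22; ring.
    by rewrite -E00 -E01 -E10 -E11; ring.
  by apply: contra_eq_neq det1 => ->; rewrite mulr0 eq_sym oner_eq0.
have [m3_lt m33 _] := mpow 3%N isT.
have [m5_lt m55 m56] := mpow 5%N isT.
have [m6_lt m66 _] := mpow 6%N isT.
have [m7_lt m77 _] := mpow 7%N isT.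
have [c23c c12c] : c23 c = 0 /\ c12 c = 0 by case: Uc => _ [? ? _ [? _ _]].
have f12 j : (j < 8)%N -> prod_coord c' (m 1%N) (m 2%N) j =
    c13 c * (m 5%N)@_j + c14 c * (m 6%N)@_j + c15 c * (m 7%N)@_j.
  move=> j8; rewrite -c'E // mM //= c12c scale0r add0r !linearD !linearZ.
  by rewrite !mxE.
have f23 : prod_coord c' (m 2%N) (m 3%N) 7 = c24 c * (m 7%N)@_7.
  by rewrite -c'E // mM //= c23c scale0r add0r linearZ mxE.
have f00 : prod_coord c' (m 0%N) (m 0%N) 7 = c00 c * (m 7%N)@_7.
  by rewrite -c'E // mM //= linearZ mxE.
(* [e1, e2] has no e 3 coordinate, whereas [m 1, m 2] has one unless m 1 lies in
   the span of e 1, ..., e 7. *)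
have m10 : (m 1%N)@_0 = 0.
  move: (f12 3%N isT); rewrite /= m20 m5_lt // m6_lt // m7_lt // !mulr0 !addr0 sub0r.
  move=> /eqP; rewrite oppr_eq0 mulf_eq0 (negPf m22_neq0) orbF.
  by move/eqP.
have {}m22 : (m 2%N)@_2 = D * A by rewrite m22 m10; ring.
have m23 : (m 2%N)@_3 = (m 1%N)@_2 * A.
  by rewrite m2E c'E // /prod_coord m10 -/A; ring.
move: m22_neq0; rewrite m22 mulf_eq0 negb_or => /andP[D0 A0].
rewrite m22 m23 -/A /= ?subSS ?subn0 in m33 m55 m56 m66 m77.
have f12_5 := f12 5%N isT; have f12_6 := f12 6%N isT.
rewrite /= m10 m20 m21 m22 -/D m55 m6_lt // m7_lt // in f12_5.
rewrite /= m10 m20 m21 m22 m23 -/D m56 // m66 m7_lt // in f12_6.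
rewrite /= m20 m21 m22 (m3_lt 0%N) // (m3_lt 1%N) // (m3_lt 2%N) // m33 m77 in f23.
rewrite /= m77 -/A in f00.
have p'E : c13 c' * D = c13 c * A ^+ 3.
  apply: (mulfI (mulf_neq0 D0 A0)).
  by transitivity (c13 c * (D * A * A ^+ 3) + c14 c * 0 + c15 c * 0);
    last ring; rewrite -f12_5; ring.
exists A, D; split=> //.
- apply: (mulfI (expf_neq0 2 A0)).
  by transitivity (c00 c * (D * A * A ^+ 5)); last ring; rewrite -f00; ring.
- apply: (mulfI (mulf_neq0 (mulf_neq0 D0 A0) (expf_neq0 2 A0))).
  by transitivity (c24 c * (D * A * A ^+ 5)); last ring; rewrite -f23; ring.
apply: (mulfI (mulf_neq0 D0 A0)).
(* The terms in the e 2 coordinate of m 1 cancel by the equation for c13. *)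
transitivity (c13 c * ((m 1%N)@_2 * A * A ^+ 3) + c14 c * (D * A * A ^+ 4)
  + c15 c * 0 - c13 c * A ^+ 3 * ((m 1%N)@_2 * A)); last by ring.
by rewrite -f12_6 -p'E; ring.
Qed.

(** * Invariants *)

(** The exponents in the first invariant are those for which the powers of [A]
    and [D] cancel: [(A^3 / D)^8 * (A^4 * D) = (A^4 / D)^7]. *)
Lemma rescaled_invariants c c' : U8_22 c -> U8_22 c' ->
  rescaled c c' <->
  c24 c' ^+ 8 * c00 c' / c14 c' ^+ 7 = c24 c ^+ 8 * c00 c / c14 c ^+ 7
  /\ c13 c' / c24 c' = c13 c / c24 c.
Proof.
move=> Uc Uc'.
have [s0 q0] : c24 c != 0 /\ c14 c != 0 by case: Uc => _ [].
have [s'0 q'0] : c24 c' != 0 /\ c14 c' != 0 by case: Uc' => _ [].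
split=> [[A [D [[A0 D0] a'E s'E p'E q'E]]]|[inv1 inv2]].
  have {}s'E : c24 c' = c24 c * A ^+ 3 / D by rewrite -s'E mulfK.
  have {}p'E : c13 c' = c13 c * A ^+ 3 / D by rewrite -p'E mulfK.
  have {}q'E : c14 c' = c14 c * A ^+ 4 / D by rewrite -q'E mulfK.
  by rewrite a'E s'E p'E q'E; split; field; rewrite ?A0 ?D0 ?s0 ?q0.
pose A := c14 c' / c14 c * (c24 c / c24 c').
have A0 : A != 0 by rewrite !(mulf_neq0, invr_neq0).
exists A, (A ^+ 3 * (c24 c / c24 c')); split.
- by rewrite !(mulf_neq0, invr_neq0, expf_neq0).
- (* c00 may vanish, so the first invariant is factored out of c00 c'. *)
  have -> : c00 c' = c24 c' ^+ 8 * c00 c' / c14 c' ^+ 7 * (c14 c' ^+ 7 / c24 c' ^+ 8).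
    by field; rewrite s'0 q'0.
  by rewrite inv1 /A; field; rewrite ?s0 ?q0 ?s'0 ?q'0.
- by field.
- have -> : c13 c' = c13 c' / c24 c' * c24 c' by field.
  by rewrite inv2; field; rewrite s0 s'0.
by rewrite /A; field; rewrite ?s0 ?q0 ?s'0 ?q'0.
Qed.

Lemma isomorphic_invariants c c' : (2 : K) != 0 -> U8_22 c -> U8_22 c' ->
  isomorphic (L c) (L c') <->
  c24 c' ^+ 8 * c00 c' / c14 c' ^+ 7 = c24 c ^+ 8 * c00 c / c14 c ^+ 7
  /\ c13 c' / c24 c' = c13 c / c24 c.
Proof.
move=> n2 Uc Uc'; rewrite -rescaled_invariants //.
by split; [apply: isomorphic_rescaled | apply: rescaled_isomorphic].
Qed.

Lemma U8_22_normal_form (l1 l2 : K) : U8_22 (Params l1 0 0 0 l2 1 0 0 1 0).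
Proof. by split; rewrite /TLeib8 /= ?mul0r // ?oner_neq0. Qed.

End Classification.

Theorem proposition2p27 (R : realType) :
  [/\ (forall c c' : params R[i], U8_22 c -> U8_22 c' ->
         isomorphic (L c) (L c') <->
         (c24 c' ^+ 8 * c00 c' / c14 c' ^+ 7 = c24 c ^+ 8 * c00 c / c14 c ^+ 7
          /\ c13 c' / c24 c' = c13 c / c24 c)),
      (forall l1 l2 : R[i], exists c : params R[i],
         [/\ U8_22 c, c24 c ^+ 8 * c00 c / c14 c ^+ 7 = l1
           & c13 c / c24 c = l2]),
      (forall l1 l2 : R[i], U8_22 (Params l1 0 0 0 l2 1 0 0 1 0)),
      (forall c : params R[i], U8_22 c -> exists l1 l2 : R[i],
         isomorphic (L c) (L (Params l1 0 0 0 l2 1 0 0 1 0)))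
    & (forall l1 l2 m1 m2 : R[i],
         isomorphic (L (Params l1 0 0 0 l2 1 0 0 1 0))
                    (L (Params m1 0 0 0 m2 1 0 0 1 0)) ->
         l1 = m1 /\ l2 = m2)].
Proof.
have n2 : (2 : R[i]) != 0 by rewrite Num.Theory.pnatr_eq0.
split=> [c c'|l1 l2|l1 l2|c Uc|l1 l2 m1 m2 /isomorphic_invariants].
- exact: isomorphic_invariants.
- exists (Params l1 0 0 0 l2 1 0 0 1 0); split=> /=.
  + exact: U8_22_normal_form.
  + by rewrite !expr1n mul1r divr1.
  + by rewrite divr1.
- exact: U8_22_normal_form.
- exists (c24 c ^+ 8 * c00 c / c14 c ^+ 7), (c13 c / c24 c).
  apply/isomorphic_invariants => //=; first exact: U8_22_normal_form.
  by rewrite !expr1n mul1r !divr1.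
move=> /(_ n2 (U8_22_normal_form _ _) (U8_22_normal_form _ _)) /=.
by rewrite !expr1n !mul1r !divr1 => -[-> ->].
Qed.
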